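(* Let $K$ be a field of characteristic zero. For all $p,n'\in\mathbb{N}$ with $n'\ge 2$, the point $p\,(n',n'-1)=(pn',p(n'-1))$ is not a possible last lower corner.
   Context: $\mathbb{N}=\{1,2,\dots\}$, $\mathbb{N}_0=\mathbb{N}\cup\{0\}$, $L=K[x,y]$, $[P,Q]=\partial_xP\,\partial_yQ-\partial_xQ\,\partial_yP$. A direction is a pair $(\rho,\sigma)\in\mathbb{Z}^2$ with $\gcd(\rho,\sigma)=1$. Let $\mathcal{D}$ be the set of directions lying strictly between $(0,-1)$ and $(1,-1)$ counterclockwise, i.e. with $\rho>0$ and $\rho+\sigma<0$; it is ordered counterclockwise: $(\rho,\sigma)<(\rho',\sigma')$ iff $\rho\sigma'-\sigma\rho'>0$. For $(\rho,\sigma)\in\mathcal{D}$ and a point $(a,b)$ write $v_{\rho,\sigma}(a,b)=\rho a+\sigma b$; also $v_{1,-1}(a,b)=a-b$. A polynomial $R$ is $(\rho,\sigma)$-homogeneous if $v_{\rho,\sigma}$ is constant on its support; for such nonzero $R$, $\operatorname{st}_{\rho,\sigma}(R)$ (resp. $\operatorname{en}_{\rho,\sigma}(R)$) is the support point with smallest (resp. largest) second coordinate. An admissible chain of length $k\in\mathbb{N}_0$ is a triple of families $\bigl((C_j)_{0\le j\le k},(R_j)_{1\le j\le k},(\rho_j,\sigma_j)_{1\le j\le k}\bigr)$ with $C_j\in\mathbb{N}_0\times\mathbb{N}_0$, $R_j\in L$, $(\rho_j,\sigma_j)\in\mathcal{D}$, such that: (1) $C_0=(l,0)$ for some $l\in\mathbb{N}$;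 (2) $(\rho_j,\sigma_j)>(\rho_{j-1},\sigma_{j-1})$ for $2\le j\le k$; and for each $1\le j\le k$: (3) $R_j$ is $(\rho_j,\sigma_j)$-homogeneous and is not a monomial; (4) $C_{j-1}=\operatorname{st}_{\rho_j,\sigma_j}(R_j)$; (5) $C_j=\operatorname{en}_{\rho_j,\sigma_j}(R_j)$; (6) $v_{1,-1}(C_j)>0$; (7) $v_{\rho_j,\sigma_j}(C_j)\ge\rho_j$; (8) there exist a $(\rho_j,\sigma_j)$-homogeneous $G_j\in L$ and $i_j\in\mathbb{N}$ such that $[G_j,R_j]=R_j^{i_j}$. A point $(a,b)\in\mathbb{N}_0\times\mathbb{N}_0$ is a possible last lower corner if there is an admissible chain (of some length $k$) with $C_k=(a,b)$. *)

(* Defs.v *)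
From mathcomp Require Import all_boot all_order all_algebra.
From mathcomp Require Export mpoly.

Set Implicit Arguments.
Unset Strict Implicit.
Unset Printing Implicit Defensive.

Import Order.TTheory GRing.Theory Num.Theory.
Local Open Scope ring_scope.

Definition point : Type := (nat * nat)%type.

Definition direction (d : int * int) : Prop := coprimez d.1 d.2.

Definition in_D (d : int * int) : Prop :=
  [/\ direction d, 0 < d.1 & d.1 + d.2 < 0].

Definition dir_lt (d d' : int * int) : Prop := 0 < d.1 * d'.2 - d.2 * d'.1.

Definition vdir (d : int * int) (c : point) : int := d.1 * c.1%:Z + d.2 * c.2%:Z.

Section Polynomials.
Variable K : fieldType.

(* K[x, y] is {mpoly K[2]}, with x = 'X_ix and y = 'X_iy. *)
Definition ix : 'I_2 := ord0.
Definition iy : 'I_2 := ord_max.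

Definition bracket (P Q : {mpoly K[2]}) : {mpoly K[2]} :=
  P^`M(ix) * Q^`M(iy) - Q^`M(ix) * P^`M(iy).

Definition in_supp (R : {mpoly K[2]}) (c : point) : Prop :=
  exists2 m : 'X_{1..2}, m \in msupp R & c = (m ix, m iy).

Definition homogeneous (d : int * int) (R : {mpoly K[2]}) : Prop :=
  forall c c' : point, in_supp R c -> in_supp R c' -> vdir d c = vdir d c'.

(* A scalar multiple of a power product; 0 counts as a monomial. *)
Definition is_monomial (R : {mpoly K[2]}) : Prop :=
  exists (a : K) (m : 'X_{1..2}), R = a *: 'X_[m].

(* [is_st R c] is c = st_(rho,sigma)(R), and [is_en R c] is
   c = en_(rho,sigma)(R), for a (rho,sigma)-homogeneous R with rho != 0: then
   two support points with the same second coordinate are equal, so c is unique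
   (lemmas is_st_uniq and is_en_uniq), and it exists exactly when R != 0. *)
Definition is_st (R : {mpoly K[2]}) (c : point) : Prop :=
  in_supp R c /\ forall c' : point, in_supp R c' -> (c.2 <= c'.2)%N.

Definition is_en (R : {mpoly K[2]}) (c : point) : Prop :=
  in_supp R c /\ forall c' : point, in_supp R c' -> (c'.2 <= c.2)%N.

Lemma homogeneous_supp_inj (d : int * int) (R : {mpoly K[2]}) (c c' : point) :
  d.1 != 0 -> homogeneous d R -> in_supp R c -> in_supp R c' ->
  c.2 = c'.2 -> c = c'.
Proof.
case: c c' => [a b] [a' b'] d0 hR Rc Rc' /= eb; subst b'.
move: (hR _ _ Rc Rc') => /addIr /(mulfI d0) [->] //.
Qed.

Lemma is_st_uniq (d : int * int) (R : {mpoly K[2]}) (c c' : point) :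
  d.1 != 0 -> homogeneous d R -> is_st R c -> is_st R c' -> c = c'.
Proof.
move=> d0 hR [Rc mc] [Rc' mc']; apply: (homogeneous_supp_inj d0 hR) => //.
by apply/eqP; rewrite eqn_leq mc // mc'.
Qed.

Lemma is_en_uniq (d : int * int) (R : {mpoly K[2]}) (c c' : point) :
  d.1 != 0 -> homogeneous d R -> is_en R c -> is_en R c' -> c = c'.
Proof.
move=> d0 hR [Rc mc] [Rc' mc']; apply: (homogeneous_supp_inj d0 hR) => //.
by apply/eqP; rewrite eqn_leq mc' // mc.
Qed.

(* The families are functions on nat: only C_0, ..., C_k, R_1, ..., R_k and
   d_1, ..., d_k matter, where d_j = (rho_j, sigma_j). *)
Record admissible_chain (k : nat) (C : nat -> point)
    (R : nat -> {mpoly K[2]}) (d : nat -> int * int) : Prop := AdmissibleChain {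
  chain_dir : forall j, (1 <= j <= k)%N -> in_D (d j);
  chain_start : exists2 l : nat, (0 < l)%N & C 0%N = (l, 0%N);
  chain_incr : forall j, (2 <= j <= k)%N -> dir_lt (d j.-1) (d j);
  chain_homog : forall j, (1 <= j <= k)%N -> homogeneous (d j) (R j);
  chain_nonmonomial : forall j, (1 <= j <= k)%N -> ~ is_monomial (R j);
  chain_st : forall j, (1 <= j <= k)%N -> is_st (R j) (C j.-1);
  chain_en : forall j, (1 <= j <= k)%N -> is_en (R j) (C j);
  chain_diag : forall j, (1 <= j <= k)%N -> 0 < vdir (1, -1) (C j);
  chain_val : forall j, (1 <= j <= k)%N -> (d j).1 <= vdir (d j) (C j);
  chain_bracket : forall j, (1 <= j <= k)%N ->
    exists (G : {mpoly K[2]}) (i : nat),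
      [/\ homogeneous (d j) G, (0 < i)%N & bracket G (R j) = R j ^+ i]
}.

Definition possible_last_lower_corner (c : point) : Prop :=
  exists (k : nat) (C : nat -> point) (R : nat -> {mpoly K[2]})
    (d : nat -> int * int), admissible_chain k C R d /\ C k = c.

End Polynomials.

Arguments possible_last_lower_corner : clear implicits.

(* Main.v *)
(* Only the last edge of the chain matters. Let (rho, sigma) be its direction,
   s = -(rho + sigma), (a, b) and (a', b') its end points, and v the weight of R.
   In terms of z = x^(-sigma) y^rho we have R = x^a y^b f(z), and
   F = G / R^(i-1) satisfies [F, R] = R and has the weight of xy, so F = xy h(z)
   with h rational. The equation becomes
     z (- s h f' - v f h') - (a - b) h f = f.
   A pole of h at a nonzero root of f of order m requires v <= s m, and a pole
   at 0 requires v <= a - b. For the point p (n', n'-1) we have s deg f < v and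
   a - b < a' - b' = p <= v, so h is a polynomial; comparing degrees and extreme
   coefficients then shows that f is constant, against R not being a monomial. *)
From HB Require Import structures.
Require Import Defs.
From mathcomp Require Import all_boot all_order all_algebra.
From mathcomp Require Import qpoly ring zify.
From Stdlib Require Import Classical.

Set Implicit Arguments.
Unset Strict Implicit.
Unset Printing Implicit Defensive.

Import Order.TTheory GRing.Theory Num.Theory.

(** * Irreducible factors and a first-order differential equation in one variable *)

Section Univariate.
Local Open Scope ring_scope.
Variable K : fieldType.
Implicit Types f g p q : {poly K}.

(* Restated so that the sizes appear at the same canonical instance everywhere,
   without which [lia] does not identify them. *)
Lemma size_mulf p q :
  p != 0 -> q != 0 -> size (p * q) = (size p + size q).-1.
Proof. exact: size_mul. Qed.

Lemma irreducible_factor p :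
  (1 < size p)%N -> exists2 q, irreducible_poly q & q %| p.
Proof.
have [n] := ubnP (size p); elim: n p => // n IHn p lt_pn p_gt1.
(* Irreducibility over an arbitrary field is not decidable, hence the classical case split. *)
have [irr|] := classic (irreducible_poly p); first by exists p.
move=> Nirr; apply: NNPP => nofactor; apply: Nirr; split=> // q q_neq1 q_dvd.
have p_neq0 : p != 0 by rewrite -size_poly_gt0 ltnW.
have q_neq0 : q != 0 by apply: contraNneq p_neq0 => q0; rewrite -dvd0p -q0.
have q_gt1 : (1 < size q)%N.
  by move: q_neq1 q_neq0; rewrite -size_poly_gt0; case: size => [|[]].
rewrite -dvdp_size_eqp // eqn_leq dvdp_leq //= leqNgt; apply/negP => lt_qp.
have [r irr_r r_dvd] := IHn q (leq_trans lt_qp lt_pn) q_gt1.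
by case: nofactor; exists r => //; apply: dvdp_trans q_dvd.
Qed.

Lemma dvdp_exp_factor p q : (1 < size q)%N -> p != 0 ->
  exists m r, p = q ^+ m * r /\ ~~ (q %| r).
Proof.
move=> q_gt1; have q_neq0 : q != 0 by rewrite -size_poly_gt0 ltnW.
have [n] := ubnP (size p); elim: n p => // n IHn p lt_pn p_neq0.
have [/dvdpP[r def_p]|Nqp] := boolP (q %| p); last first.
  by exists 0%N, p; rewrite expr0 mul1r.
have r_neq0 : r != 0 by apply: contraNneq p_neq0 => r0; rewrite def_p r0 mul0r.
have [|//|m [t [def_r Nqt]]] := IHn r.
  have r_gt0 : (0 < size r)%N by rewrite size_poly_gt0.
  by move: lt_pn q_gt1; rewrite def_p size_mulf //; lia.
by exists m.+1, t; split=> //; rewrite def_p def_r exprS mulrC mulrA.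
Qed.

Hypothesis charK : [pchar K] =i pred0.

Lemma natf_inj : injective (fun n => n%:R : K).
Proof.
have eq0 := (pcharf0P K).1 charK.
suff le m n : (n <= m)%N -> m%:R = n%:R :> K -> m = n.
  move=> m n; case: (leqP n m) => [/le//|/ltnW/le H /esym/H//].
by move=> le_nm /eqP; rewrite -subr_eq0 -natrB // eq0; lia.
Qed.

(** In characteristic zero the derivative of a nonconstant polynomial is nonzero, and its degree is
    too small for a multiple of [p]. *)
Lemma deriv_irreducible_ndvd p : irreducible_poly p -> ~~ (p %| p^`()).
Proof.
move=> irr; have p_gt1 : (1 < size p)%N := irr.1.
have p_neq0 := irredp_neq0 irr.
rewrite gtNdvdp ?lt_size_deriv //.
apply/eqP => /polyP/(_ (size p).-2); rewrite coef_deriv coef0.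
have -> : (size p).-2.+1 = (size p).-1 by lia.
rewrite -mulr_natr => /eqP; rewrite mulf_eq0 -lead_coefE lead_coef_eq0.
rewrite (negPf p_neq0) /= => /eqP n0.
by have := @natf_inj (size p).-1 0 n0; lia.
Qed.

Lemma irreducible_dvdpM p q r :
  irreducible_poly p -> (p %| q * r) = (p %| q) || (p %| r).
Proof.
move=> irr; have [pq|Npq] /= := boolP (p %| q); first exact: dvdp_mulr.
by rewrite Gauss_dvdpr // irreducible_poly_coprime.
Qed.

(** The extra factor [p] avoids the exponent [m.-1], so the formula also covers [m = 0]. *)
Lemma deriv_expM p q m :
  p * (p ^+ m * q)^`() = p ^+ m * (m%:R * p^`() * q + p * q^`()).
Proof.
rewrite derivM deriv_exp; case: m => [|m] /=; first by rewrite mulr0n; ring.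
by rewrite exprS -mulr_natl; ring.
Qed.

(* If an irreducible [p] has order [m] in [f] and [u < m] in [g], the term of
   lowest order of the left-hand side has the factor [(M v - s) m - v u], which
   must vanish; then [v] divides [s * m], although [0 < s * m < v]. *)
Lemma ode_dvdp f g (s v D M : nat) : (0 < s)%N -> (0 < M)%N ->
  f`_0 != 0 -> (s * (size f).-1 < v)%N ->
  'X * ((M%:R * v%:R - s%:R) * g * f^`() - v%:R * f * g^`()) - D%:R * g * f
    = f ^+ M.+1 ->
  f %| g.
Proof.
move=> s_gt0 M_gt0 f0 ltv ode; apply: contraT => Nfg.
have f_neq0 : f != 0 by apply: contraNneq f0 => ->; rewrite coef0.
have g_neq0 : g != 0 by apply: contraNneq Nfg => ->; rewrite dvdp0.
(* An irreducible factor of [f %/ d], with [d] the gcd, has larger order in [f] than in [g]. *)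
have def_f := divpK (dvdp_gcdl f g); set d := gcdp f g in def_f.
have q_gt1 : (1 < size (f %/ d)%R)%N.
  have : f %/ d != 0 by apply: contraNneq f_neq0 => q0; rewrite -def_f q0 mul0r.
  rewrite -size_poly_gt0 => q_gt0; rewrite ltnNge; apply: contra Nfg => q_le1.
  have /size_poly1P[c c_neq0 def_q] : size (f %/ d) == 1%N by lia.
  rewrite -def_f def_q mul_polyC dvdpZl //; exact: dvdp_gcdr.
have [p irr p_dvd] := irreducible_factor q_gt1.
have p_gt1 : (1 < size p)%N := irr.1.
have p_neq0 := irredp_neq0 irr.
have [m [f1 [ef Nf1]]] := dvdp_exp_factor p_gt1 f_neq0.
have [u [g1 [eg Ng1]]] := dvdp_exp_factor p_gt1 g_neq0.
have lt_um : (u < m)%N.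
  rewrite ltnNge; apply: contra Nf1 => le_mu.
  have pm_dvd : p ^+ m %| d.
    by rewrite dvdp_gcd {1}ef eg dvdp_mulIl dvdp_mulr // dvdp_exp2l.
  have : p * p ^+ m %| f by rewrite -def_f dvdp_mul.
  by rewrite mulrC ef dvdp_mul2l // expf_neq0.
have pX : ~~ (p %| 'X).
  apply: contra f0 => pX; have X_irr := irredp_XsubC (0 : K).
  have p_neq1 : size p != 1%N by lia.
  have := X_irr.2 p p_neq1; rewrite subr0 => /(_ pX) /eqp_dvdl eqX.
  have: 'X %| f.
    rewrite -eqX ef; case: (m) lt_um => // k _.
    by rewrite exprS -mulrA dvdp_mulIl.
  by rewrite -['X]subr0 dvdp_XsubCl rootE horner_coef0.
have le_m : (m <= (size f).-1)%N.
  have pm_dvd : p ^+ m %| f by rewrite ef dvdp_mulIl.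
  have le_pm : (size (p ^+ m)%R <= size f)%N by apply: dvdp_leq.
  have eq_pm : (size (p ^+ m)%R).-1 = ((size p).-1 * m)%N by apply: size_exp.
  by move: p_gt1; nia.
(* [Z] and [p * Y] are the two sides of the equation, multiplied by [p] and then divided by
   [p ^+ (m + u)]. For the right-hand side this uses [M > 0]: it contains [f * f], of order
   [m + m > m + u]. Modulo [p] only the terms of [Z] with the derivative of [p] survive. *)
pose Z := 'X * ((M%:R * v%:R - s%:R) * g1 * (m%:R * p^`() * f1 + p * f1^`())
              - v%:R * f1 * (u%:R * p^`() * g1 + p * g1^`()))
          - D%:R * p * g1 * f1.
pose Y := p ^+ (m - u).-1 * p * f1 * f1 * f ^+ M.-1.
have eZ : p ^+ m * p ^+ u * Z = p ^+ m * p ^+ u * (p * Y).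
  transitivity (p * f ^+ M.+1).
    rewrite -ode; transitivity
      ('X * ((M%:R * v%:R - s%:R) * g * (p * f^`()) - v%:R * f * (p * g^`()))
         - D%:R * p * g * f); last by ring.
    by rewrite [in f^`()]ef [in g^`()]eg !deriv_expM ef eg /Z; ring.
  have -> : f ^+ M.+1 = f * f * f ^+ M.-1.
    by case: (M) M_gt0 => // M' _; rewrite !exprS mulrA.
  rewrite /Y; have -> : f * f = p ^+ m * f1 * (p ^+ u * (p ^+ (m - u).-1 * p) * f1).
    by rewrite -exprSr -exprD ef; congr (_ * (_ ^+ _ * _)); lia.
  ring.
have {}eZ : Z = p * Y by apply: mulfI eZ; rewrite mulf_neq0 ?expf_neq0.
have : p %| ((M * v * m)%:R - (s * m + v * u)%:R) * ('X * (p^`() * (f1 * g1))).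
  have -> : ((M * v * m)%:R - (s * m + v * u)%:R) * ('X * (p^`() * (f1 * g1)))
    = p * (Y - 'X * ((M%:R * v%:R - s%:R) * g1 * f1^`() - v%:R * f1 * g1^`())
            + D%:R * g1 * f1).
    rewrite !mulrDr mulrN -eZ /Z natrD !natrM; ring.
  exact: dvdp_mulIl.
rewrite mulrC -!mulrA !irreducible_dvdpM // (negPf pX) (negPf Nf1) (negPf Ng1).
rewrite (negPf (deriv_irreducible_ndvd irr)) /=.
have neq : (M * v * m)%N != (s * m + v * u)%N.
  have lt_sm : (s * m < v)%N.
    by apply: leq_ltn_trans ltv; rewrite leq_mul2l le_m orbT.
  have : (v * u.+1 <= v * (M * m))%N.
    by rewrite leq_mul2l (leq_trans lt_um) ?leq_pmull ?orbT.
  by rewrite mulnS; apply: contraTneq => e; move: lt_sm e; nia.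
rewrite -!polyC_natr -polyCB => /dvdp_leq; rewrite polyC_eq0 subr_eq0.
rewrite (inj_eq natf_inj) neq size_polyC => /(_ isT).
by case: (_ != 0); move: p_gt1; lia.
Qed.

(** The operator ['X] d/dX multiplies the leading term by the degree, so the leading terms
    cancel. *)
Lemma size_euler_sub p : p != 0 ->
  (size ('X * p^`() - (size p).-1%:R * p)%R < size p)%N.
Proof.
move=> p_neq0; have p_gt0 : (0 < size p)%N by rewrite size_poly_gt0.
have -> : size p = (size p).-1.+1 by lia.
rewrite ltnS; apply/leq_sizeP => j le_j.
rewrite coefB coefXM mulr_natl coefMn coef_deriv.
case: j le_j => [|j] le_j /=.
  have -> : (size p).-1 = 0%N by lia.
  by rewrite mulr0n subrr.
have [->|neq] := eqVneq (size p).-1 j.+1; first by rewrite subrr.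
by rewrite (@nth_default _ _ p j.+1) ?mul0rn ?subrr //; lia.
Qed.

(** Writing [g = q * f], by [ode_dvdp], turns the equation for [M.+1] into the one for [M]. At
    [M = 0] comparing degrees makes [g] a constant [a]; then every exponent [j] occurring in [f]
    satisfies [(s j + D) a = -1], which cannot hold both for 0 and for the degree of [f]. *)
Lemma ode_unsolvable f g (s v D M : nat) : (0 < s)%N ->
  (1 < size f)%N -> f`_0 != 0 -> (s * (size f).-1 < v)%N ->
  'X * ((M%:R * v%:R - s%:R) * g * f^`() - v%:R * f * g^`()) - D%:R * g * f
    <> f ^+ M.+1.
Proof.
move=> s_gt0 f_gt1 f0 ltv.
have f_neq0 : f != 0 by rewrite -size_poly_gt0 ltnW.
elim: M g => [|M IHM] g ode; last first.
  have /dvdpP[q eg] : f %| g by apply: ode_dvdp ode.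
  apply: (IHM q); apply: (mulfI f_neq0); rewrite -exprS -ode eg derivM -natr1.
  ring.
have g_neq0 : g != 0.
  apply: contraNneq f_neq0 => g0; move: ode; rewrite g0 deriv0 expr1 => <-.
  by apply/eqP; ring.
have lt_f := size_euler_sub f_neq0; have lt_g := size_euler_sub g_neq0.
set f2 := _ - _ in lt_f; set g2 := _ - _ in lt_g.
(* At [M = 0] the left-hand side is [- c * g * f] up to terms of lower degree. *)
pose c := (s * (size f).-1 + v * (size g).-1 + D)%N.
have c_neq0 : c%:R != 0 :> K.
  by apply/eqP => /(@natf_inj _ 0%N); rewrite /c; nia.
have size_g : size g = 1%N.
  have ef : f = - c%:R%:P * (g * f) + - (s%:R * (g * f2) + v%:R * (f * g2)).
    rewrite -{1}[f]expr1 -ode /f2 /g2 polyC_natr /c !natrD !natrM; ring.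
  have : size f = size (g * f).
    rewrite {1}ef size_polyDl -?polyCN ?mul_polyC size_scale ?oppr_eq0 //.
    rewrite size_polyN (leq_ltn_trans (size_polyD _ _)) // gtn_max.
    have lt_M (n : nat) p q q' : q != 0 -> p != 0 -> (size q' < size p)%N ->
      (size (n%:R * (q * q'))%R < size (q * p)%R)%N.
      move=> q_neq0 p_neq0 lt_q'.
      have le_C : (size (n%:R * (q * q'))%R <= size (q * q')%R)%N.
        by rewrite -polyC_natr mul_polyC size_scale_leq.
      have le_M : (size (q * q')%R <= (size q + size q').-1)%N.
        exact: size_polyMleq.
      rewrite (size_mulf q_neq0 p_neq0).
      have : (0 < size q)%N by rewrite size_poly_gt0.
      by move: lt_q' le_M le_C; lia.
    by rewrite lt_M //= [g * f]mulrC lt_M.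
  by rewrite size_mulf //; move: f_gt1; lia.
have /eqP/size_poly1P[a a_neq0 eg] := size_g.
have ef : f = - ((s%:R * a)%:P * ('X * f^`())) - (D%:R * a)%:P * f.
  by rewrite -{1}[f]expr1 -ode eg derivC !polyCM !polyC_natr; ring.
have coefE j : f`_j != 0 -> (s * j + D)%:R * a = -1.
  move=> fj_neq0; apply: (mulIf fj_neq0); rewrite mulN1r {2}ef.
  rewrite coefB coefN !coefCM coefXM coef_deriv natrD natrM.
  case: j {fj_neq0} => [|j] /=; first by ring.
  by rewrite -[f`_j.+1 *+ _]mulr_natr; ring.
have lead_f : f`_(size f).-1 != 0 by rewrite -lead_coefE lead_coef_eq0.
have := coefE _ lead_f; rewrite -(coefE _ f0) => /(mulIf a_neq0)/natf_inj.
by move: f_gt1 s_gt0; nia.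
Qed.

(** * Products of ['X^b] with a polynomial in ['X^n] *)

Lemma comp_Xn_inj n : (0 < n)%N -> injective (fun p => p \Po 'X^n).
Proof.
move=> n_gt0 p q /= eq_pq; apply/polyP => j.
have := congr1 (fun r : {poly K} => r`_(j * n)) eq_pq.
by rewrite /= !coef_comp_poly_Xn // dvdn_mull // mulnK.
Qed.

Lemma polyXn_comp p (b n : nat) : (0 < n)%N ->
    (forall j, p`_j != 0 -> (b <= j)%N /\ (n %| j - b)%N) ->
  exists2 q, p = 'X^b * (q \Po 'X^n) & forall j, q`_j = p`_(b + n * j).
Proof.
move=> n_gt0 p_supp; pose q := \poly_(j < size p) p`_(b + n * j).
have qE j : q`_j = p`_(b + n * j).
  rewrite coef_poly; case: ltnP => // le_pj; rewrite nth_default //.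
  by apply: leq_trans le_pj _; rewrite (leq_trans _ (leq_addl _ _)) ?leq_pmull.
exists q => //; apply/polyP => j; rewrite coefXnM coef_comp_poly_Xn // qE.
have [lt_jb|le_bj] := ltnP j b.
  by apply/eqP/negPn/negP => /p_supp[]; rewrite leqNgt lt_jb.
case: ifPn => [dvd|Ndvd]; first by rewrite mulnC divnK // subnKC.
by apply/eqP/negPn/negP => /p_supp[_]; apply/negP.
Qed.

(** With z = ['X^n], the operator ['X] d/dX on ['X^b] p(z) acts on p as b + n z d/dz. *)
Lemma derivXnM_comp p (b n : nat) : (0 < n)%N ->
  'X * ('X^b * (p \Po 'X^n))^`()
    = 'X^b * ((b%:R * p + n%:R * ('X * p^`())) \Po 'X^n).
Proof.
move=> n_gt0; rewrite derivM deriv_comp !derivXn.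
rewrite comp_polyD !comp_polyM comp_polyX -!polyC_natr !comp_polyC !polyC_natr.
have XnE m : (m%:R : {poly K}) * 'X^m = 'X * ('X^(m.-1) *+ m).
  case: m => [|m]; first by rewrite mulr0n mul0r mulr0.
  by rewrite mulr_natl exprS mulrnAr.
rewrite [RHS]mulrDr.
have -> : n%:R * ('X^n * (p^`() \Po 'X^n))
    = 'X * ('X^(n.-1) *+ n) * (p^`() \Po 'X^n) by rewrite -XnE mulrA.
have -> : 'X^b * (b%:R * (p \Po 'X^n)) = 'X * ('X^(b.-1) *+ b) * (p \Po 'X^n).
  by rewrite -XnE; ring.
ring.
Qed.

(* Comparison of the powers of ['X]: [u < M * b + 1] would force [v <= D] (a pole
   at 0), [u > M * b + 1] is absurd, and for [u = M * b + 1] the equation descends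
   to [f] and [h]. *)
Lemma bracket_eq_unsolvable f (h : {poly K}) (rho s v D b u M : nat) :
    (0 < rho)%N -> (0 < s)%N -> (v + s * b = rho * D)%N -> (D < v)%N ->
    (1 < size f)%N -> (s * (size f).-1 < v)%N -> f`_0 != 0 -> h`_0 != 0 ->
  let r : {poly K} := 'X^b * (f \Po 'X^rho) in
  let g : {poly K} := 'X^u * (h \Po 'X^rho) in
  (M%:R * v%:R - s%:R) * g * r^`() - v%:R * r * g^`() <> rho%:R * r ^+ M.+1.
Proof.
move=> rho_gt0 s_gt0 eqD ltD f_gt1 ltv f0 h0 r g eq_rg.
(* In terms of z = ['X^rho], this is the left-hand side times ['X], with ['X^(b + u)] removed. *)
pose Q := (M%:R * v%:R - s%:R) * h * (b%:R * f + rho%:R * ('X * f^`()))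
   - v%:R * f * (u%:R * h + rho%:R * ('X * h^`())).
have QE : 'X^b * 'X^u * (Q \Po 'X^rho)
    = 'X^((M.+1 * b).+1) * ((rho%:R * f ^+ M.+1) \Po 'X^rho).
  have -> : 'X^((M.+1 * b).+1) * ((rho%:R * f ^+ M.+1) \Po 'X^rho)
     = 'X * (rho%:R * r ^+ M.+1).
    rewrite comp_polyM -polyC_natr comp_polyC rmorphXn /= /r exprMn -exprM.
    by rewrite exprS [(b * _)%N]mulnC; ring.
  rewrite -eq_rg.
  transitivity ((M%:R * v%:R - s%:R) * g * ('X * r^`()) - v%:R * r * ('X * g^`()));
    last by ring.
  rewrite !derivXnM_comp // /Q comp_polyB !comp_polyM comp_polyB comp_polyM.
  by rewrite -!polyC_natr !comp_polyC /r /g; ring.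
have rho_neq0 : rho%:R != 0 :> K.
  by apply/eqP => /(@natf_inj _ 0%N); move: rho_gt0; lia.
have top0 : (rho%:R * f ^+ M.+1)`_0 != 0.
  rewrite -polyC_natr coefCM mulf_neq0 // -horner_coef0 horner_exp expf_neq0 //.
  by rewrite horner_coef0.
have [lt_u|le_u] := ltnP (M * b).+1 u.
  have eq_u : 'X^b * 'X^u = 'X^((M.+1 * b).+1) * 'X * 'X^(u - (M * b).+2) :> {poly K}.
    by rewrite -exprSr -!exprD; congr (_ ^+ _); rewrite mulSn; lia.
  move: QE; rewrite eq_u -!mulrA => /(mulfI (expf_neq0 _ (negbT (polyX_eq0 _)))).
  move=> /(congr1 (fun p : {poly K} => p`_0)); rewrite /= coefXM eqxx.
  rewrite coef_comp_poly_Xn // dvdn0 div0n => /esym/eqP; exact/negP.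
pose e := ((M * b).+1 - u)%N.
have {}QE : Q \Po 'X^rho = 'X^e * ((rho%:R * f ^+ M.+1) \Po 'X^rho).
  apply: (@mulfI _ ('X^b * 'X^u)); first by rewrite -exprD expf_neq0 ?polyX_eq0.
  rewrite QE mulrA -!exprD; congr (_ ^+ _ * _); rewrite /e mulSn; lia.
have Q0 : Q`_0 = ((M * v * b)%:R - (s * b + v * u)%:R) * (h`_0 * f`_0).
  rewrite -!horner_coef0 /Q -!polyC_natr !(hornerD, hornerN, hornerM, hornerX, hornerC).
  rewrite natrD !natrM.
  ring.
have [e0|e_gt0] := posnP e.
  move: QE; rewrite e0 expr0 mul1r => /(comp_Xn_inj rho_gt0) QE.
  apply: (@ode_unsolvable f h s v D M) => //.
  apply: (@mulfI _ rho%:R); first by rewrite -polyC_natr polyC_eq0.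
  rewrite -QE /Q; have -> : u = (M * b).+1 by move: e0 le_u; rewrite /e; lia.
  (* The terms free of derivatives have coefficient [(M v - s) b - v u = - (v + s b) = - rho D], so
     [rho] cancels throughout. *)
  have eqD' : rho%:R * D%:R = v%:R + s%:R * b%:R :> {poly K}.
    by rewrite -!natrM -natrD eqD.
  rewrite -[(_ * _).+1]addn1 natrD natrM mulrBr !mulrA eqD'; ring.
have rho_e : (rho %| e)%N.
  move: (congr1 (fun p : {poly K} => p`_e) QE) => /=.
  rewrite coefXnM ltnn subnn !coef_comp_poly_Xn // dvdn0 div0n.
  by case: ifP => // _ /esym/eqP; rewrite (negPf top0).
have : Q`_0 = 0.
  move: (congr1 (fun p : {poly K} => p`_0) QE) => /=.
  by rewrite coefXnM e_gt0 coef_comp_poly_Xn // dvdn0 div0n.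
rewrite Q0 => /eqP; rewrite !mulf_eq0 (negPf h0) (negPf f0) !orbF subr_eq0.
move=> /eqP/natf_inj eq_u.
have /dvdnP[t et] := rho_e.
(* The vanishing constant coefficient of [Q] gives [v (M b - u) = s b], whence
   [v e = v + s b = rho D]; with [e = rho t] this becomes [v t = D], against [D < v]. *)
have : (v * e = rho * D)%N by move: eq_u eqD; rewrite /e; nia.
rewrite et; have : (0 < t)%N by move: e_gt0; rewrite et; case: (t).
move=> t_gt0 eqvD.
have eqvt : (v * t = D)%N.
  by apply/eqP; rewrite -(eqn_pmul2l rho_gt0) -eqvD; apply/eqP; ring.
by move: ltD; rewrite -eqvt ltnNge leq_pmulr.
Qed.
End Univariate.

(** * Weights, the Euler derivation and the substitution x = 1 *)

Section Dehomogenization.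
Local Open Scope ring_scope.
Variable K : fieldType.
Implicit Types (P Q : {mpoly K[2]}) (d : int * int) (v w : int).

(* With x = 1, a homogeneous polynomial is determined by its image, and Euler's
   identity expresses the x-derivative through the y-derivative. *)
Definition dehom P : {poly K} :=
  mmap (@polyC K) (fun i : 'I_2 => if i == ix then 1 else 'X) P.

HB.instance Definition _ := GRing.RMorphism.copy dehom
  (mmap (@polyC K) (fun i : 'I_2 => if i == ix then 1 else 'X)).

Lemma dehomXE (m : 'X_{1..2}) : dehom 'X_[m] = 'X^(m iy).
Proof.
rewrite /dehom mmapX /mmap1 !big_ord_recl big_ord0 /= expr1n mul1r mulr1.
by congr (_ ^+ m _); apply/val_inj.
Qed.

Lemma dehomZ c P : dehom (c *: P) = c *: dehom P.
Proof. by rewrite /dehom mmapZ mul_polyC. Qed.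

Lemma dehomE P : dehom P = \sum_(m <- msupp P) P@_m *: 'X^(m iy).
Proof.
rewrite {1}[P]mpolyE rmorph_sum /=; apply: eq_bigr => m _.
by rewrite dehomZ dehomXE.
Qed.

Lemma dehom_mderiv P : dehom P^`M(iy) = (dehom P)^`().
Proof.
rewrite [in RHS]dehomE /mderiv !raddf_sum /=.
apply: eq_bigr => m _; rewrite dehomZ dehomXE derivZ derivXn.
by rewrite mnmBE mnm1E eqxx subn1 mulrC -scalerA scaler_nat.
Qed.

Definition wdeg d P v := forall c, in_supp P c -> vdir d c = v.

(** The weighted Euler derivation. Weights become eigenvalues, so those of powers, derivatives and
    brackets follow from the Leibniz rule without inspecting supports. *)
Definition euler d P : {mpoly K[2]} :=
  d.1%:~R * 'X_ix * P^`M(ix) + d.2%:~R * 'X_iy * P^`M(iy).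

Lemma euler_wdeg d P v : wdeg d P v -> euler d P = v%:~R * P.
Proof.
move=> Pv; rewrite /euler [in RHS](mpolyE P) /mderiv.
rewrite !mulr_sumr -big_split /=; rewrite !big_seq; apply: eq_bigr => m mP.
have XE i : 'X_i * (((m i)%:R * P@_m) *: 'X_[m - U_(i)])
    = (m i)%:R * (P@_m *: 'X_[m]) :> {mpoly K[2]}.
  have [->|mi] := posnP (m i); first by rewrite !mul0r scale0r mulr0.
  rewrite -scalerAr -mpolyXD addmC submK ?lep1mP -?lt0n //.
  by rewrite -scalerA scaler_nat mulr_natl.
have <- := Pv (m ix, m iy) (ex_intro2 _ _ m mP erefl).
by rewrite -!mulrA !XE /vdir /= intrD !intrM; ring.
Qed.

Lemma eulerM d P Q : euler d (P * Q) = euler d P * Q + P * euler d Q.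
Proof. by rewrite /euler !mderivM; ring. Qed.

Lemma euler_exp d P v n :
  euler d P = v%:~R * P -> euler d (P ^+ n) = (v * n%:Z)%:~R * P ^+ n.
Proof.
move=> eP; elim: n => [|n IHn].
  rewrite expr0 mulr0 mul0r /euler -mpolyC1 !mderivC; ring.
by rewrite exprS eulerM IHn eP intS !intrM intrD; ring.
Qed.

Lemma mderiv_intr i (z : int) P : (z%:~R * P)^`M(i) = z%:~R * P^`M(i).
Proof. by rewrite !mulrzl raddfMz. Qed.

Lemma mderivXU (i j : 'I_2) : ('X_i)^`M(j) = (i == j)%:R :> {mpoly K[2]}.
Proof.
rewrite mderivX mnm1E; case: eqP => [->|_]; last by rewrite scale0r.
have -> : (U_(j) - U_(j))%MM = 0%MM.
  by apply/mnmP => k; rewrite mnmBE subnn mnm0E.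
by rewrite scale1r mpolyX0.
Qed.

Lemma euler_mderivx d P v : euler d P = v%:~R * P ->
  euler d P^`M(ix) = (v - d.1)%:~R * P^`M(ix).
Proof.
move/(congr1 (mderiv ix)); rewrite mderiv_intr intrB => eP.
rewrite mulrBl -eP /euler mderivD -!mulrA !mderiv_intr !mderivM !mderivXU /=.
by rewrite (mderiv_comm ix iy); ring.
Qed.

Lemma euler_mderivy d P v : euler d P = v%:~R * P ->
  euler d P^`M(iy) = (v - d.2)%:~R * P^`M(iy).
Proof.
move/(congr1 (mderiv iy)); rewrite mderiv_intr intrB => eP.
rewrite mulrBl -eP /euler mderivD -!mulrA !mderiv_intr !mderivM !mderivXU /=.
by rewrite (mderiv_comm ix iy); ring.
Qed.

Lemma euler_bracket d P Q v w :
  euler d P = v%:~R * P -> euler d Q = w%:~R * Q ->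
  euler d (bracket P Q) = (v + w - (d.1 + d.2))%:~R * bracket P Q.
Proof.
move=> eP eQ; have eB (S T : {mpoly K[2]}) : euler d (S - T) = euler d S - euler d T.
  by rewrite /euler !mderivB; ring.
rewrite /bracket eB !eulerM !(euler_mderivx eP, euler_mderivy eP).
by rewrite !(euler_mderivx eQ, euler_mderivy eQ) !(intrB, intrD); ring.
Qed.

Lemma dehom_euler d P v : wdeg d P v ->
  d.1%:~R * dehom P^`M(ix)
    = v%:~R * dehom P - d.2%:~R * 'X * (dehom P)^`().
Proof.
move=> /euler_wdeg/(congr1 dehom); rewrite /euler !(rmorphD, rmorphM, rmorph_int) /=.
rewrite !dehomXE !mnm1E !eqxx expr0 expr1 dehom_mderiv => <-.
by ring.
Qed.

(** Euler's identity eliminates both x-derivatives, and the two terms containing [d.2] cancel. *)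
Lemma dehom_bracket d P Q v w : wdeg d P v -> wdeg d Q w ->
  d.1%:~R * dehom (bracket P Q)
    = v%:~R * dehom P * (dehom Q)^`() - w%:~R * dehom Q * (dehom P)^`().
Proof.
move=> /dehom_euler eP /dehom_euler eQ.
rewrite /bracket !(rmorphD, rmorphN, rmorphM) /= !dehom_mderiv.
transitivity (d.1%:~R * dehom P^`M(ix) * (dehom Q)^`()
   - d.1%:~R * dehom Q^`M(ix) * (dehom P)^`()); first by ring.
by rewrite eP eQ; ring.
Qed.

Lemma dehom_coef_supp P n : (dehom P)`_n != 0 -> exists a, in_supp P (a, n).
Proof.
rewrite dehomE coef_sum => nz.
have [/hasP[m mP /eqP <-]|/hasPn none] :=
  boolP (has (fun m : 'X_{1..2} => m iy == n) (msupp P)).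
  by exists (m ix); exists m.
case/eqP: nz; rewrite big_seq big1 // => m /none.
by rewrite coefZ coefXn eq_sym => /negPf->; rewrite mulr0.
Qed.

(** The y-exponent determines the monomial, so no two terms merge when x = 1. *)
Lemma dehom_supp_coef d P c : d.1 != 0 -> homogeneous d P -> in_supp P c ->
  (dehom P)`_c.2 != 0.
Proof.
move=> d0 homP [m mP ->] /=; rewrite dehomE coef_sum.
rewrite (bigD1_seq m) ?msupp_uniq //= coefZ coefXn eqxx mulr1.
rewrite big_seq_cond big1 ?addr0 -?mcoeff_msupp // => m' /andP[m'P neq].
rewrite coefZ coefXn; case: eqP => [e|]; last by rewrite mulr0.
have [ex _] := homogeneous_supp_inj d0 homP (ex_intro2 _ _ m' m'P erefl)
  (ex_intro2 _ _ m mP erefl) (esym e).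
case/eqP: neq; apply/mnmP => i; case: (unliftP ord0 i) => [j|] -> //.
by rewrite (ord1 j); have -> : lift ord0 ord0 = iy by apply/val_inj.
Qed.

Lemma homogeneous_wdeg d P c : homogeneous d P -> in_supp P c -> wdeg d P (vdir d c).
Proof. by move=> homP Pc c' Pc'; apply: homP. Qed.

(** The equality reads rho (a - a') = sigma (b' - b), with rho coprime to sigma. *)
Lemma vdir_dvd d (c c' : point) : direction d -> vdir d c = vdir d c' ->
  (d.1 %| c'.2%:Z - c.2%:Z)%Z.
Proof.
move=> dd eq_v; rewrite -(Gauss_dvdzr _ dd); apply/dvdzP.
exists (c.1%:Z - c'.1%:Z); move: eq_v; rewrite /vdir => eq_v.
apply/eqP; rewrite -subr_eq0; apply/eqP.
transitivity (d.1 * c'.1%:Z + d.2 * c'.2%:Z - (d.1 * c.1%:Z + d.2 * c.2%:Z)); first by ring.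
by rewrite -eq_v subrr.
Qed.
End Dehomogenization.

(** * The bracket equation along one edge of a chain *)

Section LastEdge.
Local Open Scope ring_scope.
Variable K : fieldType.
Hypothesis charK : [pchar K] =i pred0.

Lemma intf_inj : injective (fun z : int => z%:~R : K).
Proof.
move=> y z /= /eqP; rewrite -subr_eq0 -intrB => eq0.
apply/eqP; rewrite -subr_eq0; move: eq0; case: (y - z) => n.
  by move/eqP/(@natf_inj K charK n 0) => ->.
by rewrite NegzE intrN oppr_eq0 => /eqP/(@natf_inj K charK n.+1 0).
Qed.

(** Both sides of the bracket equation are eigenvectors of the Euler derivation and [Q ^+ i] is
    nonzero, so the eigenvalues agree in [K], hence as integers. *)
Lemma bracket_wdeg d (P Q : {mpoly K[2]}) v w i : Q != 0 ->
  wdeg d P v -> wdeg d Q w -> bracket P Q = Q ^+ i ->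
  v + w - (d.1 + d.2) = w * i%:Z.
Proof.
move=> Q0 /euler_wdeg eP /euler_wdeg eQ eB.
apply: intf_inj; have := euler_bracket eP eQ.
rewrite eB (euler_exp _ eQ) => /(mulIf (expf_neq0 _ Q0)) => e.
by have := congr1 (mcoeff 0%MM) e; rewrite !raddfMz /= mcoeff1 eqxx.
Qed.

Lemma homogeneous_monomial d (P : {mpoly K[2]}) c : d.1 != 0 ->
  homogeneous d P -> in_supp P c ->
  (forall c', in_supp P c' -> c'.2 = c.2) -> is_monomial P.
Proof.
move=> d0 homP Pc eq2; have [m mP ec] := Pc.
exists P@_m, m; apply/mpolyP => m'; rewrite mcoeffZ mcoeffX.
have [<-|neq] := eqVneq m m'; first by rewrite mulr1.
rewrite mulr0; apply/eqP/negPn/negP; rewrite -mcoeff_msupp => m'P.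
have Pc' : in_supp P (m' ix, m' iy) by exists m'.
have := homogeneous_supp_inj d0 homP Pc' Pc (eq2 _ Pc'); rewrite ec => -[ex ey].
case/eqP: neq; apply/mnmP => i; case: (unliftP ord0 i) => [j|] -> //.
by rewrite (ord1 j); have -> : lift ord0 ord0 = iy by apply/val_inj.
Qed.

Lemma dehom_polyXn_comp d (P : {mpoly K[2]}) (rho b : nat) :
  direction d -> d.1 = rho%:Z -> (0 < rho)%N -> homogeneous d P ->
  (dehom P)`_b != 0 -> (forall j, (dehom P)`_j != 0 -> (b <= j)%N) ->
  exists2 q, dehom P = 'X^b * (q \Po 'X^rho)
    & forall j, q`_j = (dehom P)`_(b + rho * j).
Proof.
move=> dd d1 rho_gt0 homP /dehom_coef_supp[a Pa] min_b.
apply: polyXn_comp => // j nz; have le_bj := min_b j nz; split=> //.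
have [a' Pa'] := dehom_coef_supp nz.
by have := vdir_dvd dd (homP _ _ Pa Pa'); rewrite d1 /= subzn.
Qed.

(** If the conclusion fails, setting x = 1 leads to the equation excluded by
    [bracket_eq_unsolvable]; its hypotheses [D < v] and [s N < v] come from this failure and from
    the assumed bound on [c'.2]. *)
Lemma last_edge_bound d (R G : {mpoly K[2]}) (c c' : point) i :
  in_D d -> homogeneous d R -> ~ is_monomial R -> is_st R c -> is_en R c' ->
  homogeneous d G -> (0 < i)%N -> bracket G R = R ^+ i ->
  - (d.1 + d.2) * c'.2%:Z < d.1 * vdir d c' -> vdir d c' < vdir (1, -1) c'.
Proof.
move=> [dd d1_gt0 d12] homR nmonR [Rc min_c] [Rc' max_c'] homG i_gt0 eqGR ltv.
rewrite ltNge; apply/negP => le_v.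
have d1_neq0 : d.1 != 0 by rewrite gt_eqF.
have [rho d1] : exists rho : nat, d.1 = rho%:Z by exists (absz (d.1)); lia.
have [s d2] : exists s : nat, d.2 = - (rho + s)%N%:Z.
  by exists (absz (d.1 + d.2)); lia.
have rho_gt0 : (0 < rho)%N by lia.
have s_gt0 : (0 < s)%N by lia.
(* The left-hand side of [ltv] is nonnegative, so the weight is positive. *)
have [v ev] : exists v : nat, vdir d c' = v%:Z.
  by exists (absz (vdir d c')); rewrite gez0_abs //; nia.
have evc : vdir d c = v%:Z by rewrite -ev; apply: homR.
have R_neq0 : R != 0.
  by apply: contra_notN nmonR => /eqP->; exists 0, 0%MM; rewrite scale0r.
have G_neq0 : G != 0.
  apply: contraTneq (expf_neq0 i R_neq0) => G0.
  by rewrite -eqGR G0 /bracket !raddf0 mul0r mulr0 subrr eqxx.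
have lt_b : (c.2 < c'.2)%N.
  rewrite ltn_neqAle min_c // andbT; apply: contra_notN nmonR => /eqP eq_b.
  apply: (homogeneous_monomial d1_neq0 homR Rc) => c2 Rc2.
  by apply/eqP; rewrite eqn_leq min_c // eq_b max_c'.
(* [N] counts the steps of height [rho] along the edge; it becomes the degree of [f]. *)
have [N eN] : exists N, (c'.2 = c.2 + rho * N)%N.
  have := vdir_dvd dd (homR _ _ Rc Rc'); rewrite d1 subzn 1?ltnW // => /dvdnP[N eN].
  by exists N; move: eN; lia.
have N_gt0 : (0 < N)%N by move: lt_b; rewrite eN; case: (N); lia.
have [D [eD1 eqD]] : exists D : nat, (c.1 = c.2 + D)%N /\ (v + s * c.2 = rho * D)%N.
  have e : rho%:Z * (c.1%:Z - c.2%:Z) = v%:Z + s%:Z * c.2%:Z.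
    by rewrite -evc /vdir d1 d2 PoszD; ring.
  have : 0 <= c.1%:Z - c.2%:Z by nia.
  by move=> ge0; exists (c.1 - c.2)%N; split; nia.
have eq1 : (c'.1 = c'.2 + D + s * N)%N.
  have e : rho%:Z * (c'.1%:Z - c'.2%:Z) = v%:Z + s%:Z * c'.2%:Z.
    by rewrite -ev /vdir d1 d2 PoszD; ring.
  have {}e : rho%:Z * (c'.1%:Z - c'.2%:Z) = rho%:Z * (D%:Z + s%:Z * N%:Z).
    have {}eqD : v%:Z + s%:Z * c.2%:Z = rho%:Z * D%:Z by rewrite -!PoszM -PoszD eqD.
    by rewrite e mulrDr -eqD eN PoszD PoszM; ring.
  by move/(mulfI _): e => e; have := e (lt0r_neq0 _); lia.
(* Here [D + s N = c'.1 - c'.2 <= v] with [s N > 0]; the next bound follows from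
   [s rho N <= s c'.2 < rho v]. *)
have ltD : (D < v)%N by move: le_v; rewrite ev /vdir /= eq1; nia.
have lt_sN : (s * N < v)%N by move: ltv; rewrite ev d1 d2 eN; nia.
have [m mG] : exists m, m \in msupp G.
  by move: G_neq0; rewrite -msupp_eq0; case: msupp => // m ? _; exists m; rewrite mem_head.
have Gm : in_supp G (m ix, m iy) by exists m.
have [u gu min_u] : exists2 u, (dehom G)`_u != 0
    & forall j, (dehom G)`_j != 0 -> (u <= j)%N.
  have ex : exists u, (dehom G)`_u != 0.
    by exists (m iy); apply: (dehom_supp_coef d1_neq0 homG Gm).
  by case: (ex_minnP ex) => u; exists u.
have Rb := dehom_supp_coef d1_neq0 homR Rc.
have R_le j : (dehom R)`_j != 0 -> (c.2 <= j <= c'.2)%N.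
  by case/dehom_coef_supp=> a Ra; rewrite (min_c _ Ra) (max_c' _ Ra).
have [|f ef fE] := dehom_polyXn_comp dd d1 rho_gt0 homR Rb.
  by move=> j /R_le/andP[].
have [h eh hE] := dehom_polyXn_comp dd d1 rho_gt0 homG gu min_u.
have size_f : size f = N.+1.
  apply/eqP; rewrite eqn_leq; apply/andP; split.
    apply/leq_sizeP => j lt_Nj; rewrite fE; apply/eqP/negPn/negP => /R_le.
    by rewrite eN leq_add2l leq_pmul2l // [(j <= N)%N]leqNgt (lt_Nj : (N < j)%N) andbF.
  rewrite ltnNge; apply/negP => /leq_sizeP/(_ N (leqnn _)); rewrite fE -eN.
  by apply/eqP; apply: (dehom_supp_coef d1_neq0 homR Rc').
have wR := homogeneous_wdeg homR Rc; rewrite evc in wR.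
have wG := homogeneous_wdeg homG Gm.
have eq_deg := bracket_wdeg R_neq0 wG wR eqGR.
case: i i_gt0 eqGR eq_deg => // M _ eqGR eq_deg.
(* Comparing weights in the bracket equation, with exponent [M.+1], yields the weight of [G]. *)
have eGv : vdir d (m ix, m iy) = M%:Z * v%:Z - s%:Z.
  by move: eq_deg; rewrite d1 d2 PoszD intS => e; lia.
have := dehom_bracket wG wR; rewrite eqGR rmorphXn eGv d1 intrB intrM /= ef eh.
move=> e; apply: (@bracket_eq_unsolvable K charK f h rho s v D c.2 u M) => //;
  rewrite ?size_f ?fE ?hE ?muln0 ?addn0 //.
Qed.
End LastEdge.

Theorem proposition3p29 (K : fieldType) (charK : [pchar K]%R =i pred0)
    (p n' : nat) (hp : 1 <= p) (hn' : 2 <= n') :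
  ~ possible_last_lower_corner K (p * n', p * (n' - 1)).
Proof.
move=> [k [C [R [d [ch Ck]]]]].
(* A chain of length 0 ends on the x-axis, whereas [p (n' - 1) > 0]. *)
have k_gt0 : (0 < k)%N.
  rewrite lt0n; apply/eqP => k0; have [l _] := chain_start ch.
  by rewrite -{1}k0 Ck => -[_]; nia.
have kk : (1 <= k <= k)%N by rewrite k_gt0 leqnn.
have [G [i [homG i_gt0 eqGR]]] := chain_bracket ch kk.
have dir := chain_dir ch kk; have val_k := chain_val ch kk.
have := last_edge_bound charK dir (chain_homog ch kk)
  (chain_nonmonomial ch kk) (chain_st ch kk) (chain_en ch kk) homG i_gt0 eqGR.
case: dir => _; move: val_k; rewrite Ck /vdir /=.
case: n' hn' {Ck} => // n _; rewrite subn1 /= !PoszM intS.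
move: (d k).1 (d k).2 => rho sigma.
(* With [n = n' - 1], the end of the chain has weight [p t]. *)
pose t := (rho + (rho + sigma) * n%:Z)%R.
have -> : (rho * (p%:Z * (1 + n%:Z)) + sigma * (p%:Z * n%:Z) = p%:Z * t)%R.
  by rewrite /t; ring.
have -> : (- (rho + sigma) * (p%:Z * n%:Z) = p%:Z * (rho - t))%R.
  by rewrite /t; ring.
have -> : (1 * (p%:Z * (1 + n%:Z)) + -1 * (p%:Z * n%:Z) = p%:Z)%R by ring.
move=> le_t rho_gt0 _ bound.
have p_gt0 : (0 < p%:Z :> int)%R by lia.
(* From [0 < rho <= p t]. Then [rho - t < rho t] gives the premise of [bound], whose conclusion
   [p t < p] is impossible. *)
have t_gt0 : (0 < t)%R by rewrite -(pmulr_rgt0 _ p_gt0); apply: lt_le_trans le_t.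
have : (p%:Z * t < p%:Z)%R.
  by apply: bound; rewrite mulrCA ltr_pM2l //; nia.
by rewrite gtr_pMr //; lia.
Qed.
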